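(* Let $G$ be a $2$-path. Then $G$ is star $4$-colorable if and only if $G$ is $\{H_1,H_2\}$-free, that is, no induced subgraph of $G$ is isomorphic to $H_1$ or $H_2$. In particular, $H_1$ and $H_2$ are exactly the minimal obstructions to star $4$-colorability within the class of $2$-paths.
   Context: Graphs are finite, with no loops or parallel edges. A star coloring of $G$ is a proper vertex coloring in which no path on four vertices (as a not necessarily induced subgraph) uses only two colors; $G$ is star $k$-colorable if it has a star coloring using at most $k$ colors. A graph is a minimal obstruction to star $k$-colorability if it is not star $k$-colorable but each of its proper induced subgraphs is; the minimal obstructions within the class of $2$-paths are the $2$-paths with this property. A $2$-tree is a graph constructed from a triangle by repeatedly adding a new vertex of degree $2$ adjacent to the two endpoints of an existing edge. A $2$-path is a $2$-tree whose triangles can be ordered $T_1,\dots,T_m$ so that for each $i\ge2$ the triangle $T_i$ shares exactly one edge with $T_{i-1}$ and shares no edge with $T_j$ for $j<i-1$. (Equivalently, starting with a triangle, each new vertex after the second triangle is attached to the two endpoints of an edge containing the last added vertex.) $H_1$ is the square of the path on $7$ vertices: vertices $p_1,\dots,p_7$, with $p_ip_j$ an edge iff $1\le|i-j|\le2$. $H_2$ is the graph on the $10$ vertices $x,y,x_1,x_2,x_3,x_4,y_1,y_2,y_3,y_4$ with edges $xy$; $xx_i$ and $yy_i$ for $1\le i\le4$; $x_ix_{i+1}$ and $y_iy_{i+1}$ for $1\le i\le3$; $x_4y$; and $y_4x$. *)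

(* Defs.v *)
From mathcomp Require Import all_boot.

Set Implicit Arguments.
Unset Strict Implicit.
Unset Printing Implicit Defensive.

Record sgraph := SGraph {
  vertex :> finType;
  adj : rel vertex;
  adj_sym : symmetric adj;
  adj_irrefl : irreflexive adj
}.

Notation "x -- y" := (adj x y) (at level 30, no associativity).

Definition isomorphic (G H : sgraph) : Prop :=
  exists2 f : G -> H, bijective f & forall x y : G, f x -- f y = x -- y.

Section Induced.
Variables (G : sgraph) (S : {set G}).

Definition induced_adj : rel {x : G | x \in S} := [rel x y | val x -- val y].

Lemma induced_adj_sym : symmetric induced_adj.
Proof. by move=> x y; apply: adj_sym. Qed.

Lemma induced_adj_irrefl : irreflexive induced_adj.
Proof. by move=> x; apply: adj_irrefl. Qed.

Definition induced : sgraph := SGraph induced_adj_sym induced_adj_irrefl.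
End Induced.

Definition induced_free (H G : sgraph) : Prop :=
  forall S : {set G}, ~ isomorphic (induced S) H.

Definition proper_coloring (G : sgraph) (C : finType) (c : G -> C) : Prop :=
  forall x y : G, x -- y -> c x != c y.

Definition star_coloring (G : sgraph) (C : finType) (c : G -> C) : Prop :=
  proper_coloring c /\
  forall a b d e : G, uniq [:: a; b; d; e] -> a -- b -> b -- d -> d -- e ->
    2 < #|[set c x | x in [set a; b; d; e]]|.

Definition star_colorable (k : nat) (G : sgraph) : Prop :=
  exists c : G -> 'I_k, star_coloring c.

Definition minimal_obstruction (k : nat) (G : sgraph) : Prop :=
  ~ star_colorable k G /\
  forall S : {set G}, S \proper [set: G] -> star_colorable k (induced S).

Section TwoPaths.
Variable G : sgraph.

Definition edges : {set {set G}} :=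
  [set E | [exists x, exists y, (x -- y) && (E == [set x; y])]].

Definition triangles : {set {set G}} :=
  [set A : {set G} | (#|A| == 3) &&
    [forall x in A, forall y in A, (x != y) ==> x -- y]].

(* [two_tree_on A] says that the subgraph induced by [A] is a 2-tree. *)
Inductive two_tree_on : {set G} -> Prop :=
| two_tree_triangle A : A \in triangles -> two_tree_on A
| two_tree_add A v x y :
    two_tree_on A -> v \notin A -> x \in A -> y \in A -> x -- y ->
    [set w in A | v -- w] = [set x; y] ->
    two_tree_on (v |: A).

Definition two_tree : Prop := two_tree_on [set: G].

Definition shared_edges (A B : {set G}) : {set {set G}} :=
  [set E in edges | E \subset A :&: B].

Definition two_path : Prop :=
  two_tree /\
  exists T : seq {set G},
    [/\ uniq T, T =i triangles,
        forall i, i.+1 < size T ->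
          #|shared_edges (nth set0 T i.+1) (nth set0 T i)| = 1
      & forall i j, i < size T -> j.+1 < i ->
          shared_edges (nth set0 T i) (nth set0 T j) = set0].
End TwoPaths.

(* Truncated subtraction: the sum is the distance |m - n|. *)
Definition dist (m n : nat) : nat := (m - n) + (n - m).

Lemma distC m n : dist m n = dist n m.
Proof. exact: addnC. Qed.

Lemma distnn n : dist n n = 0.
Proof. by rewrite /dist subnn. Qed.

Definition H1_adj : rel 'I_7 := fun i j => 1 <= dist i j <= 2.

Lemma H1_adj_sym : symmetric H1_adj.
Proof. by move=> i j; rewrite /H1_adj distC. Qed.

Lemma H1_adj_irrefl : irreflexive H1_adj.
Proof. by move=> i; rewrite /H1_adj distnn. Qed.

Definition H1 : sgraph := SGraph H1_adj_sym H1_adj_irrefl.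

(* [inl true] and [inl false] are x and y; [inr (true, i)] and
   [inr (false, i)] are x_{i+1} and y_{i+1}. *)
Definition H2_adj : rel (bool + bool * 'I_4) := fun u v =>
  match u, v with
  | inl a, inl b => a != b
  | inl a, inr (b, i) | inr (b, i), inl a => (a == b) || (i == 3 :> nat)
  | inr (a, i), inr (b, j) => (a == b) && (dist i j == 1)
  end.

Lemma H2_adj_sym : symmetric H2_adj.
Proof.
by case=> [a|[a i]] [b|[b j]] //=; rewrite eq_sym // distC.
Qed.

Lemma H2_adj_irrefl : irreflexive H2_adj.
Proof. by case=> [a|[a i]] /=; rewrite ?eqxx // distnn andbF. Qed.

Definition H2 : sgraph := SGraph H2_adj_sym H2_adj_irrefl.

(* Main.v *)
Require Import Defs.
From mathcomp Require Import all_boot zify.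

Set Implicit Arguments.
Unset Strict Implicit.
Unset Printing Implicit Defensive.

(** A two-path is a strip of triangles: its vertices can be numbered so that
    each vertex j is attached to j-1 and to one further earlier vertex, the
    centre of the fan in progress. When the next vertex arrives, this centre
    either stays or turns to the vertex before last, so a two-path is encoded
    by a word of stays S and turns T (two_pathE). Numbering costs nothing but
    the count of the triangles: a 2-tree on N vertices has N-2 of them, so each
    triangle after the first contributes exactly one vertex.

    The turns read when the vertices 2 and 3 arrive can be chosen freely, by
    relabelling the first triangle. Beyond them, a factor TT of the word is an
    induced copy of H1, and a factor SSTSS, two consecutive long fans, is an
    induced copy of H2 (H1_embeds, H2_embeds).

    Conversely, a word without these factors is coloured greedily from left to
    right. The invariant uses orientations: a proper colouring is a star
    colouring as soon as the edges can be oriented so that every two-coloured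
    path on three vertices has both edges directed to its middle vertex
    (star_oriented_colorable), because the middle edge of a two-coloured path
    on four vertices would need both directions. Whether a vertex of a given
    colour can be appended then depends only on the edges at the two ends of
    the current edge, and two kinds of states suffice, fresh_state at the
    beginning of a fan and turning_state when a turn can follow. A long fan
    leaves behind a weaker fresh state, from which only a short fan can be
    coloured, and SSTSS-freeness says that a short fan comes next (ready_step).

    Neither H1 nor H2 is star 4-colourable, by exhaustive search, while each of
    their vertex-deleted subgraphs has an explicit colouring. A two-path is
    therefore star 4-colourable or contains H1 or H2, and a minimal obstruction
    that contains either of them has no further vertex. *)

(** * Induced subgraphs and star colourings *)

Definition embeds (H G : sgraph) : Prop :=
  exists2 f : H -> G, injective f & forall x y : H, f x -- f y = x -- y.

Lemma embeds_trans (F G H : sgraph) : embeds F G -> embeds G H -> embeds F H.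
Proof.
case=> f injf ef [g injg eg].
by exists (g \o f) => [|x y]; [exact: inj_comp | rewrite /= eg ef].
Qed.

Lemma isomorphic_embeds (G H : sgraph) : isomorphic G H -> embeds G H.
Proof. by case=> f /bij_inj injf ef; exists f. Qed.

Lemma isomorphic_sym (G H : sgraph) : isomorphic G H -> isomorphic H G.
Proof.
case=> f [g fK gK] ef; exists g => [|x y]; first by exists f.
by rewrite -ef !gK.
Qed.

(** On finite graphs an embedding that cannot miss a vertex is an isomorphism;
    this makes it enough to build one-sided maps. *)
Lemma embeds_isomorphic (G H : sgraph) :
  embeds G H -> #|H| <= #|G| -> isomorphic G H.
Proof. by case=> f injf ef leHG; exists f => //; apply: inj_card_bij. Qed.

Lemma induced_embeds (G : sgraph) (S : {set G}) : embeds (induced S) G.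
Proof. by exists val => //; apply: val_inj. Qed.

Lemma embeds_induced (H G : sgraph) :
  embeds H G -> exists2 S : {set G}, #|S| = #|H| & isomorphic (induced S) H.
Proof.
case=> f injf ef; have fS x : f x \in f @: [set: H] by rewrite imset_f.
have cardS : #|f @: [set: H]| = #|H| by rewrite card_imset // cardsT.
exists (f @: [set: H]) => //; apply/isomorphic_sym/embeds_isomorphic => [|/=].
  exists (fun x => Sub (f x) (fS x) : induced _) => [x y [/injf] //|x y].
  exact: ef.
by rewrite card_sig /= cardS.
Qed.

(** Embeddings compose, unlike the choice of a vertex set in the definition of
    an induced subgraph. *)
Lemma induced_freeE (H G : sgraph) : induced_free H G <-> ~ embeds H G.
Proof.
split=> [freeH /embeds_induced[S _ /freeH] //|nHG S].
move=> /isomorphic_sym/isomorphic_embeds HS.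
by apply: nHG; apply: embeds_trans HS (induced_embeds S).
Qed.

Lemma adj_neq (G : sgraph) (x y : G) : x -- y -> x != y.
Proof. by apply: contraTneq => ->; rewrite adj_irrefl. Qed.

(** In a proper colouring, a path a, b, d, e misses a third colour exactly when
    its colours alternate. That a and e differ need not be assumed: otherwise a
    and d would be adjacent vertices of the same colour. *)
Lemma star_coloringE (G : sgraph) (C : finType) (c : G -> C) :
  star_coloring c <->
  proper_coloring c /\
  forall a b d e : G, a -- b -> b -- d -> d -- e -> a != d -> b != e ->
    c a = c d -> c b <> c e.
Proof.
split=> -[propc starc]; split=> // a b d e.
  move=> ab bd de nad nbe cad cbe.
  have nae : a != e.
    by apply: contraTneq de => <-; apply/negP => /propc; rewrite cad eqxx.
  have /starc/(_ ab bd de) : uniq [:: a; b; d; e].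
    by rewrite /= !inE !negb_or nad nbe nae !adj_neq.
  rewrite ltnNge => /negP; apply.
  apply: leq_trans (_ : #|[set c a; c b]| <= 2); last by rewrite cards2 ltnS leq_b1.
  apply/subset_leq_card/subsetP => _ /imsetP[x + ->].
  by rewrite !inE => /orP[/orP[/orP[]|]|] /eqP->; rewrite -?cad -?cbe eqxx ?orbT.
rewrite /= !inE !negb_or => /and4P[/and3P[_ nad _] /andP[_ nbe] _ _] ab bd de.
pose I := [set c x | x in [set a; b; d; e]].
have cI x : x \in [set a; b; d; e] -> c x \in I by apply: imset_f.
have three x y z : x \in [set a; b; d; e] -> y \in [set a; b; d; e] ->
    z \in [set a; b; d; e] -> c x != c y -> c y != c z -> c x != c z -> 2 < #|I|.
  move=> /cI xI /cI yI /cI zI nxy nyz nxz.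
  by apply/card_gt2P; exists (c x), (c y), (c z); rewrite [c z == _]eq_sym.
have [cad|ncad] := eqVneq (c a) (c d).
  have /eqP ncbe := starc _ _ _ _ ab bd de nad nbe cad.
  by apply: (three b d e); rewrite ?inE ?eqxx ?orbT //; apply: propc.
by apply: (three a b d); rewrite ?inE ?eqxx ?orbT //; apply: propc.
Qed.

Lemma embeds_star_colorable k (H G : sgraph) :
  embeds H G -> star_colorable k G -> star_colorable k H.
Proof.
case=> f injf ef [c /star_coloringE[propc starc]].
exists (c \o f); apply/star_coloringE; split=> [x y xy|a b d e ab bd de nad nbe].
  by apply: propc; rewrite ef.
by apply: starc; rewrite ?ef ?(inj_eq injf).
Qed.

(** * Strips of triangles *)

(** Vertex j is attached to j-1 and to [centre t j], the centre of the current
    fan. [t i] records a turn when vertex i arrives: the vertex i+1 is then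
    attached to i and i-1, so that i-1 is the centre of a new fan. The values
    for j <= 2 are all 0, so the strip starts with the triangle 0, 1, 2. *)
Fixpoint centre (t : nat -> bool) (j : nat) : nat :=
  if j is i.+1 then if t i then i.-1 else centre t i else 0.

Lemma centre_leq t j : centre t j <= j.-2.
Proof. by elim: j => // j IH /=; case: ifP => _; lia. Qed.

Definition attached t i j := (i < j) && ((i == j.-1) || (i == centre t j)).

Definition strip_adj t i j := attached t i j || attached t j i.

Lemma strip_adjC t i j : strip_adj t i j = strip_adj t j i.
Proof. exact: orbC. Qed.

Lemma strip_adjnn t i : strip_adj t i i = false.
Proof. by rewrite /strip_adj /attached ltnn. Qed.

Definition strip t n : sgraph :=
  @SGraph 'I_n (fun i j => strip_adj t i j)
    (fun i j => strip_adjC t i j) (fun i => strip_adjnn t i).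

Lemma strip_adj_lt t i j :
  i < j -> strip_adj t i j = (i == j.-1) || (i == centre t j).
Proof. by move=> ij; rewrite /strip_adj /attached ij ltnNge (ltnW ij) orbF. Qed.

Lemma strip_embeds t t' n n' (g : nat -> nat) :
  (forall i, i < n -> g i < n') ->
  (forall i j, i < j < n -> g i != g j) ->
  (forall i j, i < j < n -> strip_adj t' (g i) (g j) = strip_adj t i j) ->
  embeds (strip t n) (strip t' n').
Proof.
move=> gn ginj gadj.
exists (fun i : 'I_n => Ordinal (gn i (ltn_ord i))) => [i j [gij]|i j].
  apply: (@ord_inj n); case: (ltngtP i j) => // lij.
    by have := ginj i j; rewrite lij ltn_ord gij eqxx => /(_ isT).
  by have := ginj j i; rewrite lij ltn_ord gij eqxx => /(_ isT).
rewrite /=; case: (ltngtP i j) => ij.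
- by apply: gadj; rewrite ij ltn_ord.
- by rewrite strip_adjC [RHS]strip_adjC; apply: gadj; rewrite ij ltn_ord.
- by rewrite ij !strip_adjnn.
Qed.

Lemma centre2 t : centre t 2 = 0.
Proof. by have := centre_leq t 2; case: (centre t 2). Qed.

(** A new vertex is always attached to the two ends of an edge. *)
Lemma strip_edge t m : 1 < m -> strip_adj t (centre t m) m.-1.
Proof.
move: m => [|[|m]] // _; rewrite strip_adj_lt; last exact: centre_leq t m.+2.
by rewrite /=; case: ifP; rewrite ?eqxx ?orbT.
Qed.

Lemma strip_adj_head t i j : i < j < 3 -> strip_adj t i j.
Proof.
by case/andP=> ij j3; rewrite strip_adj_lt //; move: i j ij j3 => [|[|i]] [|[|[|j]]] //;
   rewrite centre2.
Qed.

(** A permutation of the first triangle extends to the whole strip once it is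
    compatible with the edge to which vertex 3 is attached and with the centre
    used by vertex 4, since all later centres follow from the turns. *)
Lemma strip_relabel t t' n (g : nat -> nat) :
  2 < n ->
  (forall i, 2 < i -> g i = i) -> (forall i, i < 3 -> g i < 3) ->
  (forall i j, i < j < 3 -> g i != g j) ->
  (forall i, i < 3 -> strip_adj t' (g i) 3 = strip_adj t i 3) ->
  g (centre t 4) = centre t' 4 ->
  (forall j, 3 < j -> j.+1 < n -> t j = t' j) ->
  embeds (strip t n) (strip t' n).
Proof.
move=> n2 gid g3 ginj gadj3 gc4 tt'.
have gc j : 3 < j < n -> centre t' j = g (centre t j).
  elim: j => // j IH /andP[]; rewrite ltnS leq_eqVlt => /orP[/eqP<- //|j3] jn.
  rewrite /= -(tt' j j3 jn); case: ifP => _; first by rewrite gid //; lia.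
  by rewrite IH // j3 ltnW.
apply: (@strip_embeds t t' n n g) => [i ilt|i j /andP[ij _]|i j /andP[ij jn]].
- case: (ltnP i 3) => [/g3|/gid-> //] gi3; exact: leq_trans gi3 _.
- case: (ltnP j 3) => j3; first by apply: ginj; rewrite ij.
  rewrite (gid j) //; case: (ltnP i 3) => [/g3|/gid-> //]; lia.
case: (ltnP j 3) => j3.
  have i3 : i < 3 by apply: ltn_trans ij j3.
  rewrite (@strip_adj_head t) ?ij //.
  have := ginj i j; rewrite ij j3 => /(_ isT).
  case: (ltngtP (g i) (g j)) => // gij _; last rewrite strip_adjC.
    by rewrite strip_adj_head // gij g3.
  by rewrite strip_adj_head // gij g3.
rewrite (gid j) //; move: j3; rewrite leq_eqVlt => /orP[/eqP j3|j3].
  by rewrite -j3 gadj3 // j3.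
have ginj' a b : a < n -> b < n -> (g a == g b) = (a == b).
  move=> an bn; case: (ltngtP a b) => [ab|ab|->]; last by rewrite eqxx.
    case: (ltnP b 3) => b3; first by apply/negbTE/ginj; rewrite ab.
    by rewrite (gid b) //; case: (ltnP a 3) => [/g3|/gid->]; lia.
  case: (ltnP a 3) => a3; first by rewrite eq_sym; apply/negbTE/ginj; rewrite ab.
  by rewrite (gid a) //; case: (ltnP b 3) => [/g3|/gid->]; lia.
have gi_lt : g i < j by case: (ltnP i 3) => [/g3|/gid->]; lia.
have cj := centre_leq t j.
rewrite !strip_adj_lt // gc ?j3 // -{1}(gid j.-1) ?ginj' //; lia.
Qed.

(** The normal form in which vertices 3 and 4 are both attached to vertex 1:
    the edge of the first triangle shared with the second is 1, 2, and 1 is the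
    vertex common to the first three triangles. *)
Definition canonical_head t := fun j => (j == 2) || (j != 3) && t j.

Lemma canonical_head_iso t n :
  2 < n -> isomorphic (strip t n) (strip (canonical_head t) n).
Proof.
move=> n2; apply: embeds_isomorphic => //.
have [g [gid g3 ginj gadj gc]] : exists g, [/\ forall i, 2 < i -> g i = i,
    forall i, i < 3 -> g i < 3, forall i j, i < j < 3 -> g i != g j,
    forall i, i < 3 -> strip_adj (canonical_head t) (g i) 3 = strip_adj t i 3 &
    g (centre t 4) = centre (canonical_head t) 4].
  (* The list [gs] gives the new labels of 0, 1, 2: the centre of vertex 4
     becomes 1, and the vertex outside the second triangle becomes 0. *)
  pose gs : seq nat := if t 2 then if t 3 then [:: 0; 2; 1] else [:: 0; 1; 2]
                       else if t 3 then [:: 2; 0; 1] else [:: 1; 0; 2].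
  exists (fun i => if i < 3 then nth 0 gs i else i).
  split=> [i|i i3|i j /andP[ij j3]|i i3|].
  - by move=> i2; rewrite ltnNge i2.
  - by rewrite i3 /gs; case: (t 2) (t 3) i i3 => -[] [|[|[|]]].
  - rewrite j3 (ltn_trans ij j3) /gs.
    by case: (t 2) (t 3) i j ij j3 => -[] [|[|i]] [|[|[|j]]].
  - rewrite i3 /strip_adj /attached /= /gs.
    by case: (t 2) (t 3) (t 1) (t 0) i i3 => -[] [] [] [|[|[|]]].
  - by rewrite /= /gs; case: (t 2) (t 3) (t 1) (t 0) => -[] [] [].
apply: (strip_relabel n2 gid) => // j j3 _.
by rewrite /canonical_head !gtn_eqF // ltnW.
Qed.

(** The turns at 2 and 3 carry no information: they only name the vertices of
    the first triangle. *)
Lemma strip_head t t' n :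
  2 < n -> (forall j, 3 < j -> j.+1 < n -> t j = t' j) ->
  embeds (strip t n) (strip t' n).
Proof.
move=> n2 tt'.
have /isomorphic_embeds e1 := canonical_head_iso t n2.
have /isomorphic_sym/isomorphic_embeds e2 := canonical_head_iso t' n2.
apply: embeds_trans e1 _; apply: embeds_trans e2.
apply: (@strip_relabel _ _ n id) => // [i j /andP[]|[|[|[]]] //|j j3 jn].
  by move=> ij _; rewrite ltn_eqF.
by rewrite /canonical_head !gtn_eqF ?tt' // ltnW.
Qed.

Lemma strip_prefix t n n' : n <= n' -> embeds (strip t n) (strip t n').
Proof.
move=> le_nn'; apply: (@strip_embeds _ _ _ _ id) => // [i /leq_trans-> //|i j].
by case/andP=> ij _; rewrite ltn_eqF.
Qed.

(** Deleting vertex 0 shifts the word, after the head has been normalised so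
    that the remaining vertices 1, 2, 3 form the first triangle of a strip. *)
Lemma strip_behead t n :
  2 < n -> embeds (strip (fun j => t j.+1) n) (strip t n.+1).
Proof.
move=> n2; pose c := canonical_head t.
have /isomorphic_sym/isomorphic_embeds := canonical_head_iso t (ltnW n2 : 2 < n.+1).
apply: embeds_trans.
apply: (embeds_trans (G := strip (fun j => c j.+1) n)).
  by apply: strip_head => // j j3 _; rewrite /c /canonical_head !gtn_eqF //; lia.
apply: (@strip_embeds _ _ _ _ succn) => // [i j /andP[ij _]|i j /andP[ij _]].
  by rewrite eqSS ltn_eqF.
have cS k : 1 < k -> centre c k.+1 = (centre (fun j => c j.+1) k).+1.
  elim: k => // -[|[|k]] IH // _.
  by rewrite [LHS]/= [in RHS]/= -/c; case: ifP => // _; rewrite -IH.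
rewrite !strip_adj_lt //; case: j ij => [|[|j]] // ij; first by case: i ij.
by rewrite cS.
Qed.

Lemma strip_drop t n i :
  2 < n -> embeds (strip (fun j => t (j + i)) n) (strip t (n + i)).
Proof.
move=> n2; elim: i t => [|i IH] t.
  by rewrite addn0; apply: strip_head => // j _ _; rewrite addn0.
rewrite addnS; apply: embeds_trans (strip_behead _ _); last by rewrite ltn_addr.
apply: embeds_trans (IH _).
by apply: strip_head => // j _ _; rewrite addnS.
Qed.

(** A factor of the word is an induced substrip, and it has to match only from
    its fifth letter on. *)
Lemma strip_factor t t' n m i :
  2 < m -> m + i <= n -> (forall j, 3 < j -> j.+1 < m -> t' j = t (j + i)) ->
  embeds (strip t' m) (strip t n).
Proof.
move=> m2 le_mi_n tt'; apply: embeds_trans (strip_prefix t le_mi_n).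
by apply: embeds_trans (strip_drop t i m2); apply: strip_head.
Qed.

(** * The two obstructions as strips *)

(** With a turn at every step, the centre of j is j-2, which gives the square of
    a path. *)
Lemma H1_strip : isomorphic H1 (strip xpredT 7).
Proof.
exists id => [|i j]; first by exists id.
have c k : centre xpredT k = k.-2 by case: k.
rewrite /= /H1_adj /dist /strip_adj /attached !c; lia.
Qed.

(** The strip of H2 runs through the fan x, x1, ..., x4, y and then back
    through y4, ..., y1: the first fan has centre 0, the second centre 5. *)
Definition H2_label (u : H2) : nat :=
  match u with
  | inl b => if b then 0 else 5
  | inr (b, i) => if b then i.+1 else 9 - i
  end.

Lemma H2_strip : isomorphic H2 (strip (pred1 6) 10).
Proof.
have lt10 u : H2_label u < 10 by case: u => [[]|[[] [[|[|[|[|]]]]]]].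
apply: embeds_isomorphic; last by rewrite card_sum card_prod card_bool !card_ord.
exists (fun u => Ordinal (lt10 u)) => [u v [uv]|u v].
  have same_ord (i j : 'I_4) : i = j :> nat -> i = j by apply: ord_inj.
  case: u v uv => [[]|[[] [i i4]]] [[]|[[] [j j4]]] //=; rewrite ?subSS; try lia.
    by move=> ij; rewrite (same_ord (Ordinal i4) (Ordinal j4)) //=; lia.
  by move=> ij; rewrite (same_ord (Ordinal i4) (Ordinal j4)) //=; lia.
case: u v => [a|[a [i i4]]] [b|[b [j j4]]]; rewrite /= ?/dist.
- by case: a b => -[].
- by case: a b j j4 => -[] [|[|[|[|]]]].
- by case: a b i i4 => -[] [|[|[|[|]]]].
by case: a b i i4 j j4 => -[] [|[|[|[|]]]] // i4 [|[|[|[|]]]].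
Qed.

Lemma H1_embeds (t : nat -> bool) n j :
  3 < j -> j.+2 < n -> t j -> t j.+1 -> embeds H1 (strip t n).
Proof.
move=> j3 jn tj tj1; apply: embeds_trans (isomorphic_embeds H1_strip) _.
apply: (@strip_factor _ _ _ _ (j - 4)) => // [|k k3 k6]; first by lia.
have : k \in [:: 4; 5] by rewrite !inE; lia.
by rewrite !inE => /orP[] /eqP->; [rewrite subnKC | have ->: 5 + (j - 4) = j.+1 by lia].
Qed.

Lemma H2_embeds (t : nat -> bool) n j :
  3 < j -> j + 5 < n ->
  [/\ ~~ t j, ~~ t (j + 1), t (j + 2), ~~ t (j + 3) & ~~ t (j + 4)] ->
  embeds H2 (strip t n).
Proof.
move=> j3 jn [t0 t1 t2 t3 t4]; apply: embeds_trans (isomorphic_embeds H2_strip) _.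
apply: (@strip_factor _ _ _ _ (j - 4)) => // [|k k3 k9]; first by lia.
have ->: k + (j - 4) = j + (k - 4) by lia.
have : k \in [:: 4; 5; 6; 7; 8] by rewrite !inE; lia.
rewrite !inE => /or4P[||| /orP[]] /eqP->; rewrite ?addn0 /=;
  by [apply/esym/negbTE | apply/esym].
Qed.

(** * Two-paths are strips *)

Lemma triangles_adj (G : sgraph) (A : {set G}) x y :
  A \in triangles G -> x \in A -> y \in A -> x != y -> x -- y.
Proof.
by rewrite inE => /andP[_ /forall_inP adjA] /adjA/forall_inP xA /xA/implyP.
Qed.

Lemma cards3 (T : finType) (x y z : T) :
  x != y -> x != z -> y != z -> #|[set x; y; z]| = 3.
Proof.
move=> nxy nxz nyz.
by rewrite setUC cardsU1 cards2 !inE negb_or ![z == _]eq_sym nxz nyz nxy.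
Qed.

Lemma trianglesP (G : sgraph) (A : {set G}) :
  reflect (exists x y z, [/\ x -- y, x -- z, y -- z & A = [set x; y; z]])
          (A \in triangles G).
Proof.
apply: (iffP idP) => [tA|[x [y [z [xy xz yz ->]]]]].
  have /card_gt2P[x [y [z [[xA yA zA] [nxy nyz nzx]]]]] : 2 < #|A|.
    by move: tA; rewrite inE => /andP[/eqP->].
  rewrite eq_sym in nzx.
  exists x, y, z; split; try exact: (triangles_adj tA).
  apply/esym/eqP; rewrite eqEcard; apply/andP; split.
    by apply/subsetP=> u; rewrite !inE => /orP[/orP[]|] /eqP->.
  rewrite cards3 //; by move: tA; rewrite inE => /andP[/eqP->].
rewrite inE; apply/andP; split.
  by rewrite cards3 ?adj_neq.
apply/forall_inP => u; rewrite !inE => /orP[/orP[]|] /eqP->;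
  apply/forall_inP => w; rewrite !inE => /orP[/orP[]|] /eqP->;
  by rewrite ?eqxx // ?xy ?xz ?yz ?[y -- x]adj_sym ?[z -- x]adj_sym ?[z -- y]adj_sym
             ?xy ?xz ?yz implybT.
Qed.

Lemma card_triangle (G : sgraph) (A : {set G}) : A \in triangles G -> #|A| = 3.
Proof. by rewrite inE => /andP[/eqP]. Qed.

Definition covered (G : sgraph) (A : {set G}) :=
  (forall x, x \in A -> exists2 B, B \in triangles G & x \in B) /\
  (forall x y, x \in A -> y \in A -> x -- y ->
     exists2 B, B \in triangles G & (x \in B) && (y \in B)).

(** A vertex or an edge of a 2-tree always lies in a triangle, so the triangles
    determine the whole graph. *)
Lemma two_tree_covered (G : sgraph) (A : {set G}) : two_tree_on A -> covered A.
Proof.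
elim=> {A} [A tA|A v x y _ [cov cov2] vA xA yA xy nbv].
  by split=> [x xA|x y xA yA _]; exists A; rewrite ?xA.
have vadj w : w \in A -> v -- w = (w \in [set x; y]) by rewrite -nbv !inE => ->.
have vx : v -- x by rewrite vadj // !inE eqxx.
have vy : v -- y by rewrite vadj // !inE eqxx orbT.
have tB : [set v; x; y] \in triangles G by apply/trianglesP; exists v, x, y.
have cov_v w : w \in A -> v -- w ->
    exists2 B, B \in triangles G & (v \in B) && (w \in B).
  move=> wA; rewrite vadj // => wxy; exists [set v; x; y]; rewrite ?tB //.
  by move: wxy; rewrite !inE eqxx -!orbA => ->; rewrite orbT.
split=> [w|w u]; rewrite !inE.
  by case/predU1P=> [->|/cov //]; exists [set v; x; y]; rewrite // !inE eqxx.
case/predU1P=> [->|wA] /predU1P[->|uA]; rewrite ?adj_irrefl //.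
- exact: cov_v.
- by rewrite adj_sym => /(cov_v w wA)[B tB' /andP[vB wB]]; exists B; rewrite ?vB ?wB.
exact: cov2.
Qed.

(** Each new vertex of a 2-tree creates a single triangle, since its only
    neighbours are the ends of one edge. *)
Lemma card_two_tree (G : sgraph) (A : {set G}) :
  two_tree_on A -> #|[set B in triangles G | B \subset A]|.+2 = #|A|.
Proof.
elim=> {A} [A tA|A v x y _ IH vA xA yA xy nbv].
  rewrite (card_triangle tA) -(cards1 A); congr (#|pred_of_set _|).+2.
  apply/setP=> B; rewrite inE [RHS]inE; apply/andP/eqP=> [[tB sBA]|-> //].
  by apply/eqP; rewrite eqEcard sBA !card_triangle.
have inT B C : (B \in [set B in triangles G | B \subset C]) =
    (B \in triangles G) && (B \subset C) by rewrite in_set.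
have vadj w : w \in A -> v -- w = (w \in [set x; y]) by rewrite -nbv !inE => ->.
have vx : v -- x by rewrite vadj // !inE eqxx.
have vy : v -- y by rewrite vadj // !inE eqxx orbT.
have tN : [set v; x; y] \in triangles G by apply/trianglesP; exists v, x, y.
have ->: [set B in triangles G | B \subset v |: A] =
    [set v; x; y] |: [set B in triangles G | B \subset A].
  apply/setP=> B; rewrite in_setU1 !inT; apply/idP/idP.
    case/andP=> tB sB; rewrite tB /=; have [vB|vB] := boolP (v \in B).
      apply/orP; left; rewrite eqEcard !card_triangle // andbT.
      apply/subsetP=> w wB; have /setU1P[->|wA] := subsetP sB w wB.
        by rewrite !inE eqxx.
      rewrite -setUA in_setU1 -vadj // (triangles_adj tB) ?orbT //.
      by apply: contraNneq vA => ->.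
    by apply/orP; right; rewrite -(setU1K vA) subsetD1 sB.
  case/orP=> [/eqP->|/andP[tB sB]]; last by rewrite tB (subset_trans sB (subsetU1 _ _)).
  rewrite tN; apply/subsetP=> w; rewrite !inE.
  by case/orP=> [/orP[]|] /eqP->; rewrite ?eqxx ?xA ?yA ?orbT.
rewrite !cardsU1 vA -IH inT !subUset !sub1set (negbTE vA) andbF.
by rewrite addnS addnS.
Qed.

(** [in_triangle t k] holds for the indices of the triangle of a strip that
    vertex k+2 completes. *)
Definition in_triangle t k i := [|| i == k.+2, i == k.+1 | i == centre t k.+2].

Lemma in_triangle_leq t k i : in_triangle t k i -> i <= k.+2.
Proof. by have := centre_leq t k.+2; rewrite /in_triangle /=; lia. Qed.

Lemma in_triangle_adj t k i j :
  in_triangle t k i -> in_triangle t k j -> i != j -> strip_adj t i j.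
Proof.
wlog ij : i j / i < j => [lt_case ki kj nij|].
  have [ij|ji] := orP (etrans (esym (neq_ltn i j)) nij); first exact: lt_case.
  by rewrite strip_adjC; apply: lt_case => //; rewrite eq_sym.
have ck : centre t k.+2 <= k := centre_leq t k.+2.
case/or3P=> /eqP ei; case/or3P=> /eqP ej _; try lia.
- by rewrite strip_adj_lt // ej ei eqxx.
- by rewrite strip_adj_lt // ej ei eqxx orbT.
by rewrite strip_adj_lt // ej ei /=; case: ifP => _; rewrite eqxx ?orbT.
Qed.

Lemma adj_in_triangle t i j n :
  2 < n -> i < j < n -> strip_adj t i j ->
  exists2 k, k.+2 < n & in_triangle t k i && in_triangle t k j.
Proof.
move=> n2 /andP[ij jn]; rewrite strip_adj_lt //.
case: j ij jn => [|[|j]] // ij jn.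
  by case: i ij => // _ _; exists 0; rewrite // /in_triangle centre2.
move=> eij; exists j => //; rewrite /in_triangle eqxx /= andbT orbA.
by case/orP: eij => /eqP->; rewrite eqxx ?orbT.
Qed.

Definition labels (G : sgraph) t n (v : nat -> G) :=
  [/\ forall i j, i < n -> j < n -> v i = v j -> i = j,
      forall x, exists2 i, i < n & x = v i
    & forall i j, i < n -> j < n -> v i -- v j = strip_adj t i j].

Lemma labels_iso (G : sgraph) t n (v : nat -> G) :
  labels t n v -> isomorphic G (strip t n).
Proof.
case=> injv surjv adjv; apply: isomorphic_sym.
have injf : injective (fun i : 'I_n => v i).
  by move=> i j /injv eij; apply: ord_inj; apply: eij.
exists (fun i : 'I_n => v i) => [|i j]; last exact: adjv.
apply: (inj_card_bij injf); rewrite -(card_codom injf).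
apply/subset_leq_card/subsetP=> x _; have [i ilt ->] := surjv x.
by apply/codomP; exists (Ordinal ilt).
Qed.

Lemma iso_labels (G : sgraph) t n :
  0 < n -> isomorphic G (strip t n) -> exists v : nat -> G, labels t n v.
Proof.
case: n => // n _ /isomorphic_sym[f [g fK gK] ef].
exists (fun i => f (inord i)); split=> [i j ilt jlt /(can_inj fK) eij|x|i j ilt jlt].
- by rewrite -(inordK ilt) -(inordK jlt); congr nat_of_ord.
- by exists (g x : 'I_n.+1); rewrite ?inord_val ?gK.
by rewrite ef /= !inordK.
Qed.

Lemma shared_edge (G : sgraph) (A B : {set G}) :
  shared_edges A B != set0 ->
  exists x y, [/\ x -- y, x \in A :&: B & y \in A :&: B].
Proof.
case/set0Pn=> E; rewrite !inE => /andP[/existsP[x /existsP[y /andP[xy /eqP->]]]].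
by rewrite subUset !sub1set => /andP[xAB yAB]; exists x, y.
Qed.

Lemma no_shared_edge (G : sgraph) (A B : {set G}) x y :
  shared_edges A B = set0 -> x -- y -> x \in A :&: B -> y \in A :&: B -> False.
Proof.
move=> no_edge xy xAB yAB; have : [set x; y] \in shared_edges A B.
  rewrite in_set; apply/andP; split; last by rewrite subUset !sub1set xAB yAB.
  rewrite in_set; by apply/existsP; exists x; apply/existsP; exists y; rewrite xy eqxx.
by rewrite no_edge inE.
Qed.

(** In a sequence of triangles as in the definition of a two-path, call v (k+3)
    the vertex of the triangle k+1 outside the triangle k, and let the word turn
    according to whether v (k+1) is still in the triangle k+1. The vertex v (k+2)
    always is: otherwise the edge shared by the triangles k and k+1 would belong
    to the triangle k-1 as well. Hence the triangles are those of a strip. *)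
Section TriangleSequence.
Variables (G : sgraph) (T : seq {set G}).
Hypothesis treeG : two_tree G.
Hypotheses (uniqT : uniq T) (T_triangles : T =i triangles G).
Local Notation T_ k := (nth set0 T k).
Hypothesis share1 : forall i, i.+1 < size T -> #|shared_edges (T_ i.+1) (T_ i)| = 1.
Hypothesis share0 :
  forall i j, i < size T -> j.+1 < i -> shared_edges (T_ i) (T_ j) = set0.

Lemma size_triangles : (size T).+2 = #|G|.
Proof.
rewrite -cardsT -(card_two_tree treeG); congr _.+2; rewrite -(card_uniqP uniqT).
by apply: eq_card => B; rewrite in_set subsetT andbT -T_triangles.
Qed.

Lemma T_triangle k : k < size T -> T_ k \in triangles G.
Proof. by move=> km; rewrite -T_triangles mem_nth. Qed.

Lemma T_edge k : k.+1 < size T ->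
  exists x y, [/\ x -- y, x \in T_ k.+1 :&: T_ k & y \in T_ k.+1 :&: T_ k].
Proof. by move=> km; apply: shared_edge; rewrite -card_gt0 share1. Qed.

Lemma T_new k : k.+1 < size T -> T_ k.+1 :\: T_ k != set0.
Proof.
move=> km; rewrite setD_eq0; apply/negP=> sub.
have /eqP : T_ k.+1 == T_ k by rewrite eqEcard sub !card_triangle // T_triangle // ltnW.
by move/eqP; rewrite nth_uniq ?(ltnW km) // eqn_leq ltnn.
Qed.

Lemma triangles_nonempty : 0 < size T.
Proof.
have /card_gt0P[x _] : 0 < #|G| by rewrite -size_triangles.
have [B tB _] := (two_tree_covered treeG).1 x (in_setT x).
by move: tB; rewrite -T_triangles; case: T.
Qed.

(** The third vertex of the first triangle has to be chosen in the second
    triangle, where the general argument has no earlier triangle to exclude. *)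
Lemma first_triangle : 0 < size T ->
  exists a b c, T_ 0 = [set c; b; a] /\ (1 < size T -> c \in T_ 1).
Proof.
move=> m0; have [m1|m1] := ltnP 1 (size T).
  have [c [_ [_ /setIP[c1 c0] _]]] := T_edge m1.
  have /eqP : #|T_ 0 :\ c| = 2.
    by have := card_triangle (T_triangle m0); rewrite (cardsD1 c) c0 => -[].
  case/cards2P=> b [a [_ eba]]; exists a, b, c; split=> //.
  by rewrite -(setD1K c0) eba setUA.
have /trianglesP[a [b [c [_ _ _ e]]]] := T_triangle m0.
by exists c, b, a.
Qed.

Lemma triangle_sequence_labels : exists t (v : nat -> G), labels t #|G| v.
Proof.
have G0 : 0 < #|G| by rewrite -size_triangles.
have [x0 _] : exists x, x \in [set: G] by apply/card_gt0P; rewrite cardsT.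
have [cov cov2] := two_tree_covered treeG.
have m0 := triangles_nonempty.
have [a [b [c [T0 cT1]]]] := first_triangle m0.
pose v i := match i with
  | 0 => a | 1 => b | 2 => c
  | k.+3 => odflt x0 [pick x in T_ k.+1 :\: T_ k] end.
pose t j := v j.-1 \in T_ j.-1.
have new k : k.+1 < size T -> v k.+3 \in T_ k.+1 :\: T_ k.
  move=> km /=; case: pickP => [x //|none]; have /set0Pn[x] := T_new km.
  by rewrite none.
have T_v k : k < size T ->
    T_ k = [set v k.+2; v k.+1; v (centre t k.+2)] /\
    (k.+1 < size T -> v k.+2 \in T_ k.+1).
  elim: k => [_|k IH km]; first by rewrite centre2.
  have [Tk /(_ km) vT] := IH (ltnW km).
  have /setDP[newT newNT] := new k km.
  have v2T : v k.+2 \in T_ k by rewrite Tk !inE eqxx.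
  have v1T : v k.+1 \in T_ k by rewrite Tk !inE eqxx orbT.
  have vcT : v (centre t k.+2) \in T_ k by rewrite Tk !inE eqxx !orbT.
  have card3 : #|[set v k.+2; v k.+1; v (centre t k.+2)]| = 3.
    by rewrite -Tk card_triangle // T_triangle // ltnW.
  have [n21 n2c] : v k.+2 != v k.+1 /\ v k.+2 != v (centre t k.+2).
    have pair (x y : G) : #|[set x; y]| != 3 by rewrite cards2; case: (x == y).
    split; apply: contra_eq_neq card3 => ->; first by rewrite setUid.
    by rewrite setUAC setUid.
  have vc'T : v (centre t k.+3) \in T_ k.+1 :&: T_ k /\ v (centre t k.+3) != v k.+2.
    have ->: centre t k.+3 = if t k.+2 then k.+1 else centre t k.+2 by [].
    case: ifP => tk.
      by rewrite inE (tk : v k.+1 \in T_ k.+1) v1T eq_sym n21.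
    suff in_c : v (centre t k.+2) \in T_ k.+1.
      by rewrite inE in_c vcT eq_sym n2c.
    have [x [y [xy xI yI]]] := T_edge km.
    have : forall z, z \in T_ k.+1 :&: T_ k -> z = v k.+2 \/ z = v (centre t k.+2).
      move=> z /setIP[zT1]; rewrite Tk !inE => /orP[/orP[]|] /eqP ez; [by left| |by right].
      by have : (v k.+1 \in T_ k.+1) = false := tk; rewrite -ez zT1.
    move=> only; have [ex|<-] := only x xI; last by case/setIP: xI.
    have [ey|<-] := only y yI; last by case/setIP: yI.
    by move: xy; rewrite ex ey adj_irrefl.
  case: vc'T => /setIP[vc'T1 vc'T] nvc'.
  have eT : T_ k.+1 = [set v k.+3; v k.+2; v (centre t k.+3)].
    apply/esym/eqP; rewrite eqEcard; apply/andP; split.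
      by apply/subsetP=> z; rewrite !inE => /orP[/orP[]|] /eqP->.
    rewrite card_triangle ?T_triangle // cards3 //.
    - by apply: contraNneq newNT => ->.
    - by apply: contraNneq newNT => ->.
    by rewrite eq_sym.
  split=> // k2m; apply: contraT => nT2.
  have [x [y [xy xI yI]]] := T_edge k2m.
  have old z : z \in T_ k.+2 :&: T_ k.+1 -> z \in T_ k.+2 :&: T_ k.
    case/setIP=> zT2; rewrite inE zT2 eT !inE => /orP[/orP[]|] /eqP ez; rewrite ez //.
    by rewrite -ez zT2 in nT2.
  by case: (no_shared_edge (share0 k2m (ltnSn k.+1)) xy (old x xI) (old y yI)).
have T_v' k : k < size T -> forall z, z \in T_ k -> exists2 i, in_triangle t k i & z = v i.
  move=> km z; have [-> _] := T_v k km; rewrite !inE => /orP[/orP[]|] /eqP->.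
  - by exists k.+2; rewrite ?/in_triangle ?eqxx.
  - by exists k.+1; rewrite ?/in_triangle ?eqxx ?orbT.
  by exists (centre t k.+2); rewrite ?/in_triangle ?eqxx ?orbT.
have in_T k i : k < size T -> in_triangle t k i -> v i \in T_ k.
  move=> km /or3P[]/eqP->; have [-> _] := T_v k km; by rewrite !inE eqxx ?orbT.
have in_lt k i : k < size T -> in_triangle t k i -> i < #|G|.
  by move=> km /in_triangle_leq le; rewrite -size_triangles ltnS (leq_trans le).
have surjv x : exists2 i, i < #|G| & x = v i.
  have [B tB xB] := cov x (in_setT x).
  rewrite -T_triangles in tB; have km : index B T < size T by rewrite index_mem.
  have [|i ki ->] := T_v' _ km x; first by rewrite nth_index.
  by exists i => //; apply: in_lt ki.
(* Two labels could coincide a priori, but the N labels cover N vertices. *)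
have injv i j : i < #|G| -> j < #|G| -> v i = v j -> i = j.
  have uniqv : uniq (mkseq v #|G|).
    apply: (@leq_size_uniq _ (enum G)) => [||]; first exact: enum_uniq.
      move=> x _; have [k klt ->] := surjv x.
      by apply/mapP; exists k; rewrite ?mem_iota.
    by rewrite size_mkseq cardE.
  move=> ilt jlt /eqP; rewrite -(nth_mkseq a v ilt) -(nth_mkseq a v jlt).
  by rewrite nth_uniq ?size_mkseq // => /eqP.
exists t, v; split=> // i j ilt jlt; have [->|nij] := eqVneq i j.
  by rewrite adj_irrefl strip_adjnn.
have nvij : v i != v j by apply: contraNneq nij => /(injv _ _ ilt jlt)->.
apply/idP/idP=> [vij|].
  have [B tB /andP[iB jB]] := cov2 _ _ (in_setT _) (in_setT _) vij.
  rewrite -T_triangles in tB; have km : index B T < size T by rewrite index_mem.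
  rewrite -(nth_index set0 tB) in iB jB.
  have [i' ki' /(injv _ _ ilt (in_lt _ _ km ki')) ei] := T_v' _ km _ iB.
  have [j' kj' /(injv _ _ jlt (in_lt _ _ km kj')) ej] := T_v' _ km _ jB.
  by apply: in_triangle_adj nij; [rewrite ei; apply: ki' | rewrite ej; apply: kj'].
have n2 : 2 < #|G| by rewrite -size_triangles.
wlog ij : i j ilt jlt nij nvij / i < j => [lt_case|] aij.
  have [ij|ji] := orP (etrans (esym (neq_ltn i j)) nij); first exact: lt_case.
  by rewrite adj_sym; apply: lt_case; rewrite // 1?strip_adjC // eq_sym.
have [k kn /andP[ki kj]] := adj_in_triangle n2 (introT andP (conj ij jlt)) aij.
have km : k < size T by move: kn; rewrite -size_triangles.
exact: triangles_adj (T_triangle km) (in_T _ _ km ki) (in_T _ _ km kj) nvij.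
Qed.
End TriangleSequence.

(** Conversely, the triangles of a labelled strip, in the order of their last
    vertices, satisfy the conditions on a two-path. *)
Section Labelled.
Variables (G : sgraph) (t : nat -> bool) (n : nat) (v : nat -> G).
Hypotheses (n2 : 2 < n) (lab : labels t n v).

Let injv i j : i < n -> j < n -> v i = v j -> i = j.
Proof. by case: lab => + _ _; apply. Qed.
Let surjv x : exists2 i, i < n & x = v i.
Proof. by case: lab. Qed.
Let adjv i j : i < n -> j < n -> v i -- v j = strip_adj t i j.
Proof. by case: lab => _ _; apply. Qed.

Let V m := [set x in mkseq v m].

Let in_V m x : reflect (exists2 i, i < m & x = v i) (x \in V m).
Proof.
rewrite inE; apply: (iffP mapP) => -[i im ->]; exists i => //; move: im;
  by rewrite mem_iota.
Qed.

Let tri k := [set v k.+2; v k.+1; v (centre t k.+2)].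

Let triP k x : reflect (exists2 i, in_triangle t k i & x = v i) (x \in tri k).
Proof.
apply: (iffP idP) => [|[i /or3P[]/eqP-> ->]]; rewrite !inE ?eqxx ?orbT //.
case/orP=> [/orP[]|] /eqP->; [exists k.+2 | exists k.+1 | exists (centre t k.+2)] => //;
  by rewrite /in_triangle eqxx ?orbT.
Qed.

Let tri_lt k i : k.+2 < n -> in_triangle t k i -> i < n.
Proof. by move=> kn /in_triangle_leq le; apply: leq_ltn_trans kn. Qed.

Let mem_tri k i : k.+2 < n -> i < n -> v i \in tri k -> in_triangle t k i.
Proof. by move=> kn ilt /triP[j kj /(injv ilt (tri_lt kn kj))->]. Qed.

Let tri_triangle k : k.+2 < n -> tri k \in triangles G.
Proof.
move=> kn; have ck : centre t k.+2 <= k := centre_leq t k.+2.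
have vadj i j : in_triangle t k i -> in_triangle t k j -> i != j -> v i -- v j.
  by move=> ki kj nij; rewrite adjv ?(in_triangle_adj ki kj) ?(tri_lt kn).
apply/trianglesP; exists (v k.+2), (v k.+1), (v (centre t k.+2)).
by split=> //; apply: vadj; rewrite /in_triangle ?eqxx ?orbT //; lia.
Qed.

(** The two neighbours that the last vertex of a triangle has in it are earlier
    ones, and a vertex has only two earlier neighbours. *)
Let triangle_tri B : B \in triangles G -> exists2 k, k.+2 < n & B = tri k.
Proof.
move=> tB; pose P i := (i < n) && (v i \in B).
have exP : exists i, P i.
  have : 0 < #|B| by rewrite (card_triangle tB).
  by case/card_gt0P=> x xB; have [i ilt ex] := surjv x; exists i; rewrite /P ilt -ex.
have leP i : P i -> i <= n by case/andP=> /ltnW.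
case: (ex_maxnP exP leP) => l /andP[ln lB] maxl.
have inB x : x \in B -> exists i, [/\ i <= l, x = v i & i = l \/ strip_adj t i l].
  move=> xB; have [i ilt ex] := surjv x; exists i.
  have il : i <= l by apply: maxl; rewrite /P ilt -ex.
  split=> //; have [->|nil] := eqVneq i l; [by left | right].
  rewrite -adjv // -ex (triangles_adj tB) // ex.
  by apply: contraNneq nil => /injv->.
have l2 : 1 < l.
  rewrite ltnNge; apply/negP=> l1; have : #|B| <= #|[set v 0; v 1]|.
    apply/subset_leq_card/subsetP=> x /inB[i [il -> _]].
    have : i <= 1 by apply: leq_trans l1.
    by rewrite !inE; case: i {il} => [|[|]] //; rewrite eqxx ?orbT.
  by rewrite card_triangle // cards2; case: (v 0 == v 1).
case: l l2 ln {lB maxl} inB => [|[|k]] // _ kn inB; exists k => //.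
apply/eqP; rewrite eqEcard !card_triangle ?tri_triangle // andbT.
apply/subsetP=> x /inB[i [il -> eil]]; apply/triP; exists i => //.
case: eil => [->|]; first by rewrite /in_triangle eqxx.
move: il; rewrite leq_eqVlt => /orP[/eqP->|il]; first by rewrite strip_adjnn.
by rewrite strip_adj_lt // /in_triangle => ->; rewrite orbT.
Qed.

Let V_two_tree m : 2 < m <= n -> two_tree_on (V m).
Proof.
elim: m => // m IH /andP[m2 mn]; move: m2; rewrite ltnS leq_eqVlt => /orP[/eqP<-|m2].
  have -> : V 3 = tri 0.
    apply/setP=> x; apply/in_V/triP=> -[i i3 ->]; exists i => //.
      by rewrite /in_triangle centre2; case: i i3 => [|[|[|]]].
    by rewrite ltnS (in_triangle_leq i3).
  exact/two_tree_triangle/tri_triangle.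
have cm : centre t m < m by have := centre_leq t m; lia.
have m1 : m.-1 < m by lia.
have -> : V m.+1 = v m |: V m.
  apply/setP=> x; rewrite in_setU1; apply/in_V/predU1P=> [[i]|[->|/in_V[i im ->]]].
  - rewrite ltnS leq_eqVlt => /orP[/eqP-> ->|im ->]; first by left.
    by right; apply/in_V; exists i.
  - by exists m.
  by exists i => //; apply: ltnW.
apply: (@two_tree_add _ (V m) (v m) (v m.-1) (v (centre t m))).
- by apply: IH; rewrite m2 ltnW.
- by apply/in_V=> -[i im /(injv mn (ltn_trans im mn)) ei]; rewrite -ei ltnn in im.
- by apply/in_V; exists m.-1.
- by apply/in_V; exists (centre t m).
- rewrite (adjv (ltn_trans m1 mn) (ltn_trans cm mn)) strip_adjC.
  by apply: strip_edge; lia.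
apply/setP=> x; rewrite in_set in_set2; apply/andP/orP=> [[/in_V[i im ->]]|].
  rewrite (adjv mn (ltn_trans im mn)) strip_adjC strip_adj_lt //.
  by case/orP=> /eqP->; rewrite eqxx; [left | right].
have mi i : i < m -> (i == m.-1) || (i == centre t m) -> v i \in V m /\ v m -- v i.
  move=> im mi; split; first by apply/in_V; exists i.
  by rewrite (adjv mn (ltn_trans im mn)) strip_adjC strip_adj_lt.
by case=> /eqP->; apply: mi; rewrite ?eqxx ?orbT.
Qed.

Lemma labels_two_path : two_path G.
Proof.
have szT : size (mkseq tri n.-2) = n.-2 by rewrite size_mkseq.
have lt2 k : k < n.-2 -> k.+2 < n by lia.
split.
  rewrite /two_tree (_ : [set: G] = V n); first by apply: V_two_tree; rewrite n2 leqnn.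
  by apply/setP=> x; rewrite in_setT; apply/esym/in_V; have [i] := surjv x; exists i.
have shareP i j x : i.+2 < n -> j < i ->
    x \in tri i :&: tri j -> exists a, [/\ x = v a, a < n, in_triangle t i a & a <= j.+2].
  move=> iltn ji /setIP[/triP[a ia ->] aj]; have an := tri_lt iltn ia.
  exists a; split=> //; apply: in_triangle_leq (mem_tri _ an aj); lia.
exists (mkseq tri n.-2); rewrite szT; split.
- apply/mkseq_uniqP=> i j; rewrite !inE => /lt2 iltn /lt2 jltn eij.
  have le_ij a b : a.+2 < n -> b.+2 < n -> tri a = tri b -> a <= b.
    move=> an bn eab; rewrite -2!ltnS; apply: in_triangle_leq (mem_tri bn an _).
    by rewrite -eab !inE eqxx.
  by apply/eqP; rewrite eqn_leq; apply/andP; split; apply: le_ij.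
- move=> B; apply/mapP/idP=> [[k]|/triangle_tri[k kn ->]].
    by rewrite mem_iota => /lt2 kn ->; apply: tri_triangle.
  by exists k; rewrite // mem_iota; lia.
- move=> k km; rewrite !nth_mkseq ?(ltnW km) //.
  have kn := lt2 _ km; have ck : centre t k.+3 <= k.+1 := centre_leq t k.+3.
  have in_k1 i : in_triangle t k.+1 i -> i <= k.+2 -> i = k.+2 \/ i = centre t k.+3.
    by case/or3P=> /eqP->; [rewrite ltnn | left | right].
  pose S := [set v k.+2; v (centre t k.+3)].
  have adjS : v k.+2 -- v (centre t k.+3).
    rewrite adjv; try lia; apply: (@in_triangle_adj _ k.+1);
      by rewrite /in_triangle ?eqxx ?orbT //; lia.
  have S_sub : S \subset tri k.+1 :&: tri k.
    have ck' : in_triangle t k (centre t k.+3).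
      by rewrite /in_triangle /=; case: ifP; rewrite eqxx ?orbT.
    rewrite subUset !sub1set; apply/andP; split; apply/setIP; split; apply/triP.
    + by exists k.+2; rewrite // /in_triangle eqxx ?orbT.
    + by exists k.+2; rewrite // /in_triangle eqxx ?orbT.
    + by exists (centre t k.+3); rewrite // /in_triangle eqxx ?orbT.
    by exists (centre t k.+3).
  rewrite (_ : shared_edges _ _ = [set S]) ?cards1 //; apply/setP=> E.
  rewrite in_set in_set1; apply/andP/eqP=> [[]|->].
    rewrite in_set => /existsP[x /existsP[y /andP[xy /eqP->]]].
    rewrite subUset !sub1set => /andP[xI yI].
    have inS z : z \in tri k.+1 :&: tri k -> z \in S.
      case/(shareP _ _ _ kn (ltnSn k))=> a [-> _ k1a ak]; rewrite !inE.
      by case: (in_k1 a k1a ak) => ->; rewrite eqxx ?orbT.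
    apply/eqP; rewrite eqEcard !cards2 (adj_neq xy) (adj_neq adjS) andbT.
    by rewrite subUset !sub1set !inS.
  split=> //; rewrite in_set; apply/existsP; exists (v k.+2); apply/existsP.
  by exists (v (centre t k.+3)); rewrite adjS eqxx.
move=> i j im ji; have iltn := lt2 _ im.
rewrite !nth_mkseq //; last by lia.
apply/eqP; apply: contraT => /shared_edge[x [y [xy xI yI]]].
have only z : z \in tri i :&: tri j -> z = v (centre t i.+2).
  case/(shareP _ _ _ iltn (ltnW ji))=> a [-> _ /or3P[]/eqP-> //]; lia.
by move: xy; rewrite (only x xI) (only y yI) adj_irrefl.
Qed.
End Labelled.

Lemma two_pathE (G : sgraph) :
  two_path G <-> exists t n, 2 < n /\ isomorphic G (strip t n).
Proof.
split=> [[treeG [T [uT eT s1 s0]]]|[t [n [n2 isoG]]]].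
  have [t [v lab]] := triangle_sequence_labels treeG uT eT s1 s0.
  exists t, #|G|; split; last exact: labels_iso lab.
  by rewrite -(size_triangles treeG uT eT) !ltnS (triangles_nonempty treeG uT eT).
have [v lab] := iso_labels (ltnW (ltnW n2)) isoG.
exact: labels_two_path n2 lab.
Qed.

(** * Colouring strips *)

Section Colouring.
Variable t : nat -> bool.
Implicit Types (c : nat -> 'I_4) (o : rel nat).

Local Notation nb := (strip_adj t).

(** A certificate for star colourings that can be checked at each vertex: [o i j]
    means that the edge between i and j is directed to j, and two neighbours of
    the same colour must both be directed to their common neighbour. The
    two-coloured components are then stars, directed to their centres. *)
Definition star_oriented n c o :=
  (forall i j, i < n -> j < n -> nb i j -> c i != c j /\ o i j = ~~ o j i) /\
  (forall x y z, x < n -> y < n -> z < n -> nb x y -> nb x z -> y != z ->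
     c y = c z -> o y x).

(** On a two-coloured path a, b, d, e, the edge between b and d would have to be
    directed to b because of a and d, and to d because of b and e. *)
Lemma star_oriented_colorable n c o :
  star_oriented n c o -> star_colorable 4 (strip t n).
Proof.
case=> prop_c in_c; exists (fun i : 'I_n => c i); apply/star_coloringE; split.
  by move=> i j; move/(prop_c i j (ltn_ord i) (ltn_ord j)) => [].
move=> a b d e /= ab bd de nad nbe cad cbe.
have ob : o d b by apply: (in_c b d a) => //; rewrite 1?strip_adjC // eq_sym.
have od : o b d by apply: (in_c d b e) => //; rewrite strip_adjC.
by have [_] := prop_c b d (ltn_ord b) (ltn_ord d) bd; rewrite od ob.
Qed.

Definition extend_colour (m : nat) (k : 'I_4) c : nat -> 'I_4 :=
  fun i => if i == m then k else c i.

(** The bits [ia] and [ib] tell whether the edges from the new vertex m to the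
    centre and to m-1 are directed away from m. *)
Definition extend_orientation (m : nat) (ia ib : bool) o : rel nat := fun i j =>
  if i == m then (if j == m.-1 then ib else ia)
  else if j == m then (if i == m.-1 then ~~ ib else ~~ ia) else o i j.

(** The condition under which x may receive a new neighbour of colour k, the new
    edge being directed to x if [inward] holds, and away from x otherwise. *)
Definition accepts n c o x k (inward : bool) :=
  forall y, y < n -> nb x y -> c y = k -> inward && o y x.

Lemma nb_new m y : 1 < m -> y < m -> nb y m = (y == m.-1) || (y == centre t m).
Proof. by move=> m1 ym; rewrite strip_adj_lt. Qed.

Lemma star_oriented_step m c o k ia ib :
  1 < m -> star_oriented m c o -> nb (centre t m) m.-1 ->
  k != c (centre t m) -> k != c m.-1 ->
  accepts m c o (centre t m) k ia -> accepts m c o m.-1 k ib ->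
  star_oriented m.+1 (extend_colour m k c) (extend_orientation m ia ib o).
Proof.
move=> m1 [prop_c in_c] ab nka nkb acc_a acc_b.
have cm := centre_leq t m.
set a := centre t m in ab nka acc_a cm *; set b := m.-1 in ab nkb acc_b *.
have am : a < m by lia.
have bm : b < m by lia.
have nab : a != b by lia.
have nbm y : y < m -> nb y m -> y = a \/ y = b.
  by move=> ym; rewrite nb_new // => /orP[]/eqP->; [right|left].
have ltS i : i < m.+1 -> i = m \/ i < m.
  by rewrite ltnS leq_eqVlt => /orP[/eqP|]; [left|right].
split=> [i j|x y z]; rewrite /extend_colour /extend_orientation.
  move=> /ltS[->|im] /ltS[->|jm].
  - by rewrite strip_adjnn.
  - rewrite eqxx (ltn_eqF jm) strip_adjC => /(nbm j jm)[]->.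
      by rewrite (negbTE nab) negbK.
    by rewrite eqxx negbK.
  - rewrite eqxx (ltn_eqF im) => /(nbm i im)[]->; rewrite eq_sym.
      by rewrite (negbTE nab).
    by rewrite eqxx.
  - by rewrite (ltn_eqF im) (ltn_eqF jm); apply: prop_c.
case/ltS=> [->|xm].
  (* The neighbours a and b of the new vertex are adjacent, so they do not have
     the same colour. *)
  case/ltS=> [->|ym]; first by rewrite strip_adjnn.
  case/ltS=> [->|zm]; first by rewrite strip_adjnn.
  rewrite ![nb m _]strip_adjC => /(nbm y ym) ey /(nbm z zm) ez nyz.
  have [ncab _] := prop_c a b am bm ab.
  rewrite (ltn_eqF ym) (ltn_eqF zm).
  case: ey ez nyz => -> [] ->; rewrite ?eqxx // => _ /eqP.
    by rewrite (negbTE ncab).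
  by rewrite eq_sym (negbTE ncab).
rewrite (ltn_eqF xm) => /ltS[->|ym] /ltS[->|zm].
- by rewrite eqxx.
- rewrite eqxx (ltn_eqF zm) => /(nbm x xm)[]-> xz _ ckz.
    by rewrite (negbTE nab); case/andP: (acc_a z zm xz (esym ckz)).
  by rewrite eqxx; case/andP: (acc_b z zm xz (esym ckz)).
- rewrite eqxx (ltn_eqF ym) => xy /(nbm x xm)[ex|ex] _ cyk; rewrite ex in xy *.
    by case/andP: (acc_a y ym xy cyk).
  by case/andP: (acc_b y ym xy cyk).
by rewrite (ltn_eqF ym) (ltn_eqF zm); apply: in_c.
Qed.

Definition all_in n c o x := forall k, accepts n c o x k true.

(** The state at the beginning of a fan with centre a, whose last vertex is b.
    A vertex of the colour of b may be attached to a, and some fourth colour l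
    occurs around neither a nor b. The state is [strong] if moreover all edges
    at a are directed to a, which allows a fan of any length. *)
Definition fresh_state strong m c o :=
  let a := centre t m in let b := m.-1 in
  [/\ accepts m c o a (c b) true,
      exists l, [/\ l != c a, l != c b, accepts m c o a l false & accepts m c o b l false]
    & strong -> all_in m c o a].

(** The state in which the fan with centre a may turn to its last vertex b: some
    colour k can be given to the next vertex, with both edges directed away from
    it. If the edge between a and b is directed to b (a [short] fan), then all
    edges at b will be directed to b and the next fan starts in a strong state.
    Otherwise all edges at a are directed to a, and the fan may also go on. *)
Definition turning_state short m c o :=
  let a := centre t m in let b := m.-1 in
  exists2 k, [/\ k != c a, k != c b, accepts m c o a k true
    & forall y, y < m -> nb b y -> y != a -> c y = k /\ o y b]
  & if short then is_true (o a b) else all_in m c o a.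

Lemma other_colour (x y z : 'I_4) : exists k, [/\ k != x, k != y & k != z].
Proof.
have : 0 < #|~: [set x; y; z]|.
  rewrite cardsCs setCK card_ord subn_gt0.
  by rewrite (leq_ltn_trans (leq_card_setU _ _)) // cards1 cards2; case: (_ == _).
by case/card_gt0P=> k; rewrite !inE !negb_or -andbA => /and3P[]; exists k.
Qed.

Lemma accepts_weaken n c o x k : accepts n c o x k false -> accepts n c o x k true.
Proof. by move=> acc y yn xy cy; case/andP: (acc y yn xy cy). Qed.

Section Step.
Variables (m : nat) (c : nat -> 'I_4) (o : rel nat) (k : 'I_4) (ia ib : bool).
Hypothesis m1 : 1 < m.
Let a := centre t m.
Let b := m.-1.
Let c' := extend_colour m k c.
Let o' := extend_orientation m ia ib o.

Lemma step_lt : [/\ a < m, b < m & a != b].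
Proof. by have := centre_leq t m; rewrite /a /b; split; lia. Qed.

Lemma extend_colour_old x : x < m -> c' x = c x.
Proof. by move=> xm; rewrite /c' /extend_colour ltn_eqF. Qed.

Lemma extend_colour_new : c' m = k.
Proof. by rewrite /c' /extend_colour eqxx. Qed.

Lemma extend_orientation_old x y : x < m -> y < m -> o' x y = o x y.
Proof. by move=> xm ym; rewrite /o' /extend_orientation !ltn_eqF. Qed.

Lemma extend_orientationE :
  [/\ o' m a = ia, o' m b = ib, o' a m = ~~ ia & o' b m = ~~ ib].
Proof.
have [am bm nab] := step_lt.
by rewrite /o' /extend_orientation !eqxx -/b !(ltn_eqF am) !(ltn_eqF bm) (negbTE nab).
Qed.

Lemma new_neighbour y : y < m.+1 -> nb m y -> y = a \/ y = b.
Proof.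
rewrite ltnS leq_eqVlt => /orP[/eqP->|ym]; first by rewrite strip_adjnn.
by rewrite strip_adjC nb_new // => /orP[]/eqP->; [right | left].
Qed.

Lemma accepts_old x k' inward :
  x < m -> accepts m c o x k' inward ->
  (nb m x -> k = k' -> inward && o' m x) ->
  accepts m.+1 c' o' x k' inward.
Proof.
move=> xm acc new y; rewrite ltnS leq_eqVlt => /orP[/eqP->|ym] xy.
  by rewrite extend_colour_new; apply: new; rewrite strip_adjC.
by rewrite extend_colour_old // extend_orientation_old //; apply: acc.
Qed.
End Step.

(** The new vertex takes the fourth colour, with both edges directed to it; the
    colour for the turn is that of b. *)
Lemma fresh_short strong m c o :
  1 < m -> star_oriented m c o -> fresh_state strong m c o ->
  exists c' o', star_oriented m.+1 c' o' /\
    (~~ t m -> turning_state true m.+1 c' o').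
Proof.
move=> m1 oriented [in_cb [l [nla nlb acc_a acc_b]] _].
have [am bm nab] := step_lt m1; have ab := strip_edge t m1.
have [ncab _] := oriented.1 _ _ am bm ab.
exists (extend_colour m l c), (extend_orientation m false false o); split.
  exact: star_oriented_step.
move=> /negbTE tm; rewrite /turning_state /= tm.
have [_ _ oam obm] := extend_orientationE o false false m1.
exists (c m.-1); last by rewrite oam.
rewrite extend_colour_new extend_colour_old //; split=> //; try by rewrite eq_sym.
  by apply: accepts_old => // _ /eqP; rewrite (negbTE nlb).
move=> y /(new_neighbour m1) ey /ey[]->; first by rewrite eqxx.
by rewrite extend_colour_old // obm.
Qed.

(** As in a short fan, but the edge to the centre is directed to the centre. *)
Lemma fresh_long m c o :
  1 < m -> star_oriented m c o -> fresh_state true m c o ->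
  exists c' o', star_oriented m.+1 c' o' /\
    (~~ t m -> turning_state false m.+1 c' o').
Proof.
move=> m1 oriented [in_cb [l [nla nlb acc_a acc_b]] /(_ isT) in_a].
have [am bm nab] := step_lt m1; have ab := strip_edge t m1.
have [ncab _] := oriented.1 _ _ am bm ab.
exists (extend_colour m l c), (extend_orientation m true false o); split.
  by apply: star_oriented_step => //; apply: accepts_weaken.
move=> /negbTE tm; rewrite /turning_state /= tm.
have [oma _ _ obm] := extend_orientationE o true false m1.
have in_a' : all_in m.+1 (extend_colour m l c) (extend_orientation m true false o)
                (centre t m).
  by move=> k; apply: accepts_old => //; rewrite oma.
exists (c m.-1) => //.
rewrite extend_colour_new extend_colour_old //; split=> //; try by rewrite eq_sym.
move=> y /(new_neighbour m1) ey /ey[]->; first by rewrite eqxx.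
by rewrite extend_colour_old // obm.
Qed.

(** A long fan goes on: its rim is a directed path in three cyclically repeated
    colours, and all its spokes are directed to the centre. *)
Lemma turning_stay m c o :
  1 < m -> star_oriented m c o -> turning_state false m c o ->
  exists c' o', star_oriented m.+1 c' o' /\
    (~~ t m -> turning_state false m.+1 c' o').
Proof.
move=> m1 oriented [k [nka nkb acc_a in_b] in_a].
have [am bm nab] := step_lt m1; have ab := strip_edge t m1.
have [ncab _] := oriented.1 _ _ am bm ab.
have [l [nla nlb nlk]] := other_colour (c (centre t m)) (c m.-1) k.
exists (extend_colour m l c), (extend_orientation m true false o); split.
  apply: star_oriented_step => // y ym yb cy.
  have [eya|nya] := eqVneq y (centre t m); first by rewrite -cy eya eqxx in nla.
  by have [eyk _] := in_b y ym yb nya; rewrite -cy eyk eqxx in nlk.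
move=> /negbTE tm; rewrite /turning_state /= tm.
have [oma _ _ obm] := extend_orientationE o true false m1.
have in_a' : all_in m.+1 (extend_colour m l c) (extend_orientation m true false o)
                (centre t m).
  by move=> k'; apply: accepts_old => //; rewrite oma.
exists (c m.-1) => //.
rewrite extend_colour_new extend_colour_old //; split=> //; try by rewrite eq_sym.
move=> y /(new_neighbour m1) ey /ey[]->; first by rewrite eqxx.
by rewrite extend_colour_old // obm.
Qed.

(** The new vertex repeats the colour k around the old last vertex, which becomes
    the centre; around it only k and the colour of the old centre occur, so a
    fourth colour is again available. *)
Lemma turning_turn short m c o :
  1 < m -> star_oriented m c o -> turning_state short m c o ->
  exists c' o', star_oriented m.+1 c' o' /\
    (t m -> fresh_state short m.+1 c' o').
Proof.
move=> m1 oriented [k [nka nkb acc_a in_b] oab].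
have [am bm nab] := step_lt m1; have ab := strip_edge t m1.
have [ncab _] := oriented.1 _ _ am bm ab.
have other_b y : y < m -> nb m.-1 y -> y = centre t m \/ c y = k /\ o y m.-1.
  by move=> ym yb; case: (eqVneq y (centre t m)) => [|/(in_b y ym yb)]; [left|right].
exists (extend_colour m k c), (extend_orientation m true true o); split.
  apply: star_oriented_step => // y ym /(other_b y ym)[->|[_ -> //]] cy.
  by rewrite cy eqxx in nka.
move=> tm; rewrite /fresh_state /= tm.
have [oma omb _ _] := extend_orientationE o true true m1.
rewrite extend_colour_new extend_colour_old //; split.
- apply: accepts_old => // y ym /(other_b y ym)[->|[_ -> //]] cy.
  by rewrite cy eqxx in nka.
- have [l [nla nlb nlk]] := other_colour (c (centre t m)) (c m.-1) k.
  exists l; split=> //.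
    apply: accepts_old => // [y ym /(other_b y ym)[->|[-> _]] cy|_ ekl].
    + by rewrite cy eqxx in nla.
    + by rewrite cy eqxx in nlk.
    by rewrite ekl eqxx in nlk.
  move=> y /(new_neighbour m1) ey /ey[]->; rewrite extend_colour_old // => cy.
    by rewrite cy eqxx in nla.
  by rewrite cy eqxx in nlb.
case: short oab => // oab _ l.
by apply: accepts_old => // y ym /(other_b y ym)[->|[_ ->]].
Qed.

(** The word of a strip on n vertices consists of the letters [t j] with
    2 <= j and j+1 < n, which explains the bounds below. *)
Variable n : nat.
Hypothesis no_tt : forall j, 1 < j -> j.+2 < n -> ~~ (t j && t j.+1).
Hypothesis no_ssTss : forall j, 1 < j -> j + 5 < n ->
  ~ [/\ ~~ t j, ~~ t (j + 1), t (j + 2), ~~ t (j + 3) & ~~ t (j + 4)].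

(** The states reached by the colouring, with what the word still allows. A fan
    that begins in a weak fresh state must be short. A long fan is in progress in
    the last case: the letter before m is a stay, and a turn at m comes only after
    two stays. *)
Definition ready m c o :=
  [\/ exists2 strong : bool, fresh_state strong m c o &
        (m.+1 < n -> ~~ t m) /\ (~~ strong -> m.+2 < n -> t m.+1),
      turning_state true m c o /\ (m.+1 < n -> t m)
    | turning_state false m c o /\
      [/\ 2 < m, ~~ t m.-1 & m.+1 < n -> t m -> 3 < m /\ ~~ t m.-2]].

(** One letter of lookahead decides between a short and a long fan; this is the
    only choice. *)
Lemma ready_step m c o :
  1 < m < n -> star_oriented m c o -> ready m c o ->
  exists c' o', star_oriented m.+1 c' o' /\ (m.+1 < n -> ready m.+1 c' o').
Proof.
case/andP=> m1 mn oriented [[strong fresh [tm short]]|[turn tm]|[turn [m2 tm1 tm]]].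
- have [long|not_long] := boolP [&& strong, m.+2 < n & ~~ t m.+1].
    case/and3P: long => es m2n tm1; rewrite {}es in fresh.
    have [c' [o' [oriented' turn]]] := fresh_long m1 oriented fresh.
    exists c', o'; split=> // m1n; apply: Or33; split; first exact/turn/tm.
    by split=> [//||_]; [exact: tm | rewrite (negbTE tm1)].
  have [c' [o' [oriented' turn]]] := fresh_short m1 oriented fresh.
  exists c', o'; split=> // m1n; apply: Or32; split=> [|m2n]; first exact/turn/tm.
  move: not_long; rewrite m2n; case: (strong) short => /= [_|]; first by rewrite negbK.
  by move/(_ isT m2n).
- have [c' [o' [oriented' fresh]]] := turning_turn m1 oriented turn.
  exists c', o'; split=> // m1n; apply: Or31; exists true; first exact/fresh/tm.
  by split=> // m2n; have := no_tt m1 m2n; rewrite tm.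
have [tm'|tm'] := boolP (t m).
  have [c' [o' [oriented' fresh]]] := turning_turn m1 oriented turn.
  exists c', o'; split=> // m1n; apply: Or31; exists false; first exact/fresh.
  (* The letters m-2, ..., m read SST; if m+1 and m+2 were both stays, the next
     fan would be long too. *)
  have [m3 tm2] := tm m1n tm'.
  have ntm1 : m.+2 < n -> ~~ t m.+1 by move=> m2n; have := no_tt m1 m2n; rewrite tm'.
  split=> // _ m3n; apply: contraT => ntm2.
  case: m m1 m3 tm1 tm2 tm' m3n ntm1 ntm2
      {mn oriented turn tm m2 oriented' fresh m1n} => [|[|j]] //.
  rewrite !ltnS /= => _ j1 tj1 tj tj2 jn ntj3 ntj4.
  case: (no_ssTss j1); first by rewrite addnS !addn4 in jn *.
  by rewrite addn1 addn2 addn3 addn4 ntj3 // ltnW.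
have [c' [o' [oriented' turn']]] := turning_stay m1 oriented turn.
exists c', o'; split=> // m1n; apply: Or33; split; first exact: turn'.
by split=> [||_ tm1']; rewrite ?(ltnW m1).
Qed.

(** The first edge can be seen as the beginning of a fan or, with the opposite
    orientation, as a fan about to turn; the first letter selects one. *)
Lemma ready_base : exists c o, star_oriented 2 c o /\ ready 2 c o.
Proof.
pose i0 : 'I_4 := ord0; pose i1 : 'I_4 := lift ord0 ord0.
pose c i := if i == 0 then i0 else i1.
pose o : rel nat := fun i j => if t 2 then i < j else j < i.
have nb01 : nb 0 1 by rewrite strip_adj_lt.
exists c, o; split.
  split=> [[|[|i]] [|[|j]]|[|[|x]] [|[|y]] [|[|z]]] //; rewrite ?strip_adjnn // /o.
    by case: (t 2).
  by case: (t 2).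
have [t2|t2] := boolP (t 2).
  apply: Or32; split=> //; rewrite /turning_state centre2 /=.
  have [k [nk0 nk1 _]] := other_colour i0 i1 i0.
  exists k; last by rewrite /o t2.
  split=> //; last by move=> [|[|y]] // _; rewrite ?strip_adjnn.
  by move=> [|[|y]] // _ _ ck; rewrite -ck in nk1.
apply: Or31; exists true => //; rewrite /fresh_state centre2 /=.
have in0 : all_in 2 c o 0.
  by move=> k [|[|y]] //; rewrite ?strip_adjnn // /o (negbTE t2).
split=> //.
have [k [nk0 nk1 _]] := other_colour i0 i1 i0.
by exists k; split=> // -[|[|y]] // _ _ ck; [rewrite -ck in nk1|rewrite -ck in nk0].
Qed.

Lemma avoiding_strip_colorable : 1 < n -> star_colorable 4 (strip t n).
Proof.
move=> n1.
have all_m m : 1 < m <= n ->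
    exists c o, star_oriented m c o /\ (m < n -> ready m c o).
  elim: m => // m IH /andP[m1 mn]; move: m1; rewrite ltnS leq_eqVlt => /orP[/eqP<-|m1].
    by have [c [o [oriented rdy]]] := ready_base; exists c, o.
  have /IH[c [o [oriented /(_ mn) rdy]]] : 1 < m <= n by rewrite m1 ltnW.
  by apply: ready_step rdy; rewrite ?m1.
have /all_m[c [o [oriented _]]] : 1 < n <= n by rewrite n1 leqnn.
exact: star_oriented_colorable oriented.
Qed.
End Colouring.

(** * The obstructions are minimal *)

(** The star condition on a list of colours. The nested conditionals make
    evaluation skip the inner enumerations whenever an edge is missing. *)
Definition star_seq t (s : seq nat) : bool :=
  let c := nth 0 s in let I := iota 0 (size s) in
  all (fun a => all (fun b =>
    if strip_adj t a b then
      (c a != c b) && all (fun d =>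
        if [&& strip_adj t b d, a != d & c a == c d] then
          all (fun e => if strip_adj t d e && (b != e) then c b != c e else true) I
        else true) I
    else true) I) I.

(** Backtracking search over the colour lists of the first vertices. Pruning is
    sound because star colourings restrict to the prefixes of a strip. *)
Fixpoint extendable t k fuel s : bool :=
  if star_seq t s then
    if fuel is f.+1 then has (fun x => extendable t k f (rcons s x)) (iota 0 k)
    else true
  else false.

Lemma star_seqP t s :
  reflect ((forall a b, a < size s -> b < size s -> strip_adj t a b ->
              nth 0 s a != nth 0 s b) /\
           (forall a b d e, a < size s -> b < size s -> d < size s -> e < size s ->
              strip_adj t a b -> strip_adj t b d -> strip_adj t d e ->
              a != d -> b != e -> nth 0 s a = nth 0 s d -> nth 0 s b <> nth 0 s e))
          (star_seq t s).
Proof.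
have inI a : (a \in iota 0 (size s)) = (a < size s) by rewrite mem_iota.
apply: (iffP allP) => [star | [prop star] a].
  have star' a b : a < size s -> b < size s -> strip_adj t a b ->
      nth 0 s a != nth 0 s b /\ (forall d e, d < size s -> e < size s ->
        strip_adj t b d -> strip_adj t d e ->
        a != d -> b != e -> nth 0 s a = nth 0 s d -> nth 0 s b <> nth 0 s e).
    rewrite -!inI => aI bI ab; have /allP/(_ b bI) := star a aI.
    rewrite ab => /andP[-> /allP star_d]; split=> // d e; rewrite -!inI => dI eI bd de.
    move=> nad nbe cad; have := star_d d dI.
    rewrite bd nad cad eqxx => /allP/(_ e eI); by rewrite de nbe => /eqP.
  split=> [a b aI bI /(star' a b aI bI)[]//|a b d e aI bI dI eI ab].
  by have [_] := star' a b aI bI ab; apply.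
rewrite inI => aI; apply/allP=> b; rewrite inI => bI; case: ifP => // ab.
rewrite prop //=; apply/allP=> d; rewrite inI => dI.
case: ifP => // /and3P[bd nad /eqP cad].
apply/allP=> e; rewrite inI => eI; case: ifP => // /andP[de nbe].
by apply/eqP; apply: (star a b d e).
Qed.

Lemma star_colorable_extendable t k n :
  star_colorable k (strip t n) -> extendable t k n [::].
Proof.
case=> c /star_coloringE[propc starc].
pose f i := if insub i is Some j then val (c (j : 'I_n)) else 0.
have fE i (ilt : i < n) : f i = c (Ordinal ilt) by rewrite /f insubT.
have good m : m <= n -> star_seq t (mkseq f m).
  move=> mn; apply/star_seqP; rewrite size_mkseq; split.
    move=> a b am bm; have an := leq_trans am mn; have bn := leq_trans bm mn.
    rewrite !nth_mkseq // !fE; exact: (propc (Ordinal an) (Ordinal bn)).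
  move=> a b d e am bm dm em; have an := leq_trans am mn; have bn := leq_trans bm mn.
  have dn := leq_trans dm mn; have en := leq_trans em mn.
  rewrite !nth_mkseq // !fE => ab bd de nad nbe /ord_inj cad /ord_inj.
  exact: (starc (Ordinal an) (Ordinal bn) (Ordinal dn) (Ordinal en)).
suff ext m l : m + l <= n -> extendable t k l (mkseq f m) by apply: (ext 0 n).
elim: l m => [|l IH] m mln /=; first by rewrite good // -[m]addn0.
rewrite good; last by apply: leq_trans mln; rewrite leq_addr.
have mn : m < n by apply: leq_trans mln; rewrite addnS ltnS leq_addr.
apply/hasP; exists (f m); first by rewrite mem_iota fE ltn_ord.
by rewrite -mkseqS; apply: IH; rewrite addSnnS.
Qed.

(** Row x of [L] is a star colouring in which the colour of x may exceed the k
    available ones. It restricts to a star k-colouring once x is deleted. *)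
Definition deletion_colourings t k n (L : seq (seq nat)) : bool :=
  all (fun x => let s := nth [::] L x in
    [&& size s == n, star_seq t s
      & all (fun y => (y == x) || (nth 0 s y < k)) (iota 0 n)])
  (iota 0 n).

Lemma deletion_colourings_proper t k n L (S : {set strip t n}) :
  0 < k -> deletion_colourings t k n L -> S \proper [set: strip t n] ->
  star_colorable k (induced S).
Proof.
case: k => // k _ /allP del /properP[_ [x _ xS]].
have xn : (x : nat) \in iota 0 n by rewrite mem_iota ltn_ord.
have /and3P[/eqP szs /star_seqP[prop star] /allP le_k] := del x xn.
set s := nth _ _ _ in szs prop star le_k; rewrite szs in prop star.
pose w (y : induced S) : nat := val (val y : 'I_n).
have wn y : w y < n by apply: ltn_ord.
have sk y : nth 0 s (w y) < k.+1.
  have := le_k (w y); rewrite mem_iota wn => /(_ isT) /predU1P[wx|//].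
  by move: (valP y) xS; rewrite (_ : val y = x) ?(eqP _) => [->|]; last exact: ord_inj.
exists (fun y => inord (nth 0 s (w y))); apply/star_coloringE; split.
  move=> y z yz; apply: contraNneq (prop _ _ (wn y) (wn z) yz) => /(congr1 val) /=.
  by rewrite !inordK // => ->.
move=> a b d e ab bd de nad nbe /(congr1 val) /=.
rewrite !inordK // => cad /(congr1 val) /=.
by rewrite !inordK //; apply: (star (w a) (w b) (w d) (w e)).
Qed.

Lemma H1_not_colorable : ~ star_colorable 4 H1.
Proof.
move=> colH; have /isomorphic_sym/isomorphic_embeds H1s := H1_strip.
have := star_colorable_extendable (embeds_star_colorable H1s colH).
by vm_compute.
Qed.

Lemma H2_not_colorable : ~ star_colorable 4 H2.
Proof.
move=> colH; have /isomorphic_sym/isomorphic_embeds H2s := H2_strip.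
have := star_colorable_extendable (embeds_star_colorable H2s colH).
by vm_compute.
Qed.

Lemma isomorphic_proper_colorable k (G H : sgraph) :
  isomorphic G H ->
  (forall S : {set H}, S \proper [set: H] -> star_colorable k (induced S)) ->
  forall S : {set G}, S \proper [set: G] -> star_colorable k (induced S).
Proof.
case=> f [g fK gK] ef colH S /properP[_ [x _ xS]].
have fS y : y \in S -> f y \in f @: S by apply: imset_f.
apply: (@embeds_star_colorable k _ (induced (f @: S))); last first.
  apply/colH/properP; split; first exact: subsetT.
  by exists (f x); rewrite ?inE // mem_imset //; apply: can_inj fK.
exists (fun y : induced S => Sub (f (val y)) (fS _ (valP y)) : induced (f @: S)).
  by move=> y z [/(can_inj fK)/val_inj].
by move=> y z; apply: ef.
Qed.

Lemma H1_proper_colorable (S : {set H1}) :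
  S \proper [set: H1] -> star_colorable 4 (induced S).
Proof.
apply: (isomorphic_proper_colorable H1_strip) => {}S.
apply: (@deletion_colourings_proper _ _ _
  [:: [:: 4; 0; 1; 2; 3; 0; 1];
      [:: 0; 4; 1; 0; 2; 3; 0];
      [:: 0; 1; 4; 0; 2; 3; 0];
      [:: 0; 1; 2; 4; 0; 1; 3];
      [:: 0; 1; 2; 0; 4; 3; 0];
      [:: 0; 1; 2; 0; 3; 4; 0];
      [:: 0; 1; 2; 3; 0; 1; 4]]) => [//|].
by vm_compute.
Qed.

Lemma H2_proper_colorable (S : {set H2}) :
  S \proper [set: H2] -> star_colorable 4 (induced S).
Proof.
apply: (isomorphic_proper_colorable H2_strip) => {}S.
apply: (@deletion_colourings_proper _ _ _
  [:: [:: 4; 0; 1; 0; 2; 1; 0; 2; 0; 3];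
      [:: 0; 4; 1; 2; 1; 3; 1; 2; 0; 1];
      [:: 0; 1; 4; 1; 2; 3; 1; 2; 0; 1];
      [:: 0; 1; 2; 4; 1; 3; 1; 2; 0; 1];
      [:: 0; 1; 2; 1; 4; 3; 1; 2; 0; 1];
      [:: 0; 1; 2; 1; 3; 4; 1; 2; 0; 1];
      [:: 0; 1; 2; 1; 3; 2; 4; 1; 3; 1];
      [:: 0; 1; 2; 1; 3; 2; 1; 4; 1; 3];
      [:: 0; 1; 2; 1; 3; 2; 1; 3; 4; 1];
      [:: 0; 1; 2; 1; 3; 2; 1; 3; 1; 4]]) => [//|].
by vm_compute.
Qed.

(** * The characterisation *)

Lemma strip_trichotomy t n :
  2 < n ->
  [\/ star_colorable 4 (strip t n), embeds H1 (strip t n) | embeds H2 (strip t n)].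
Proof.
move=> n2; pose TT j := [&& 3 < j, j.+2 < n, t j & t j.+1].
have [/existsP[j /and4P[j3 jn tj tj1]]|noTT] := boolP [exists j : 'I_n, TT j].
  by apply: Or32; apply: H1_embeds tj tj1.
pose SSTSS j := [&& 3 < j, j + 5 < n, ~~ t j, ~~ t (j + 1), t (j + 2),
  ~~ t (j + 3) & ~~ t (j + 4)].
have [/existsP[j /and5P[j3 jn t0 t1 /and3P[t2 t3 t4]]]|noSSTSS] :=
    boolP [exists j : 'I_n, SSTSS j].
  by apply: Or33; apply: (H2_embeds j3 jn).
apply: Or31.
(* The turns at 2 and 3 are free; they are chosen so that the prefix creates no
   forbidden factor with the letters that follow: TST if 4 is a turn, STS if
   not. *)
pose t' j := if j < 4 then (if j == 2 then t 4 else ~~ t 4) else t j.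
have tt' j : 3 < j -> t' j = t j by move=> j3; rewrite /t' ltnNge j3.
apply: (@embeds_star_colorable _ _ (strip t' n)).
  by apply: strip_head => // j j3 _; rewrite tt'.
apply: avoiding_strip_colorable => [j j1 jn|j j1 jn|]; last exact: ltnW.
  apply/negP=> /andP[tj tj1]; have [j3|j3] := ltnP 3 j.
    rewrite tt' // in tj; rewrite tt' ?ltnS ?(ltnW j3) // in tj1.
    case/existsP: noTT; exists (Ordinal (ltnW (ltnW jn))).
    by rewrite /TT /= j3 jn tj.
  by case: j j1 j3 tj tj1 {jn} => [|[|[|[|j]]]] // _ _; rewrite /t' /=; case: (t 4).
case=> tj tj1 tj2 tj3 tj4; have [j3|j3] := ltnP 3 j.
  rewrite !tt' ?ltn_addr // in tj tj1 tj2 tj3 tj4.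
  case/existsP: noSSTSS; exists (Ordinal (leq_ltn_trans (leq_addr 5 j) jn)).
  by rewrite /SSTSS /= j3 jn tj tj1 tj2 tj3.
case: j j1 j3 tj tj1 tj2 {tj3 tj4 jn} => [|[|[|[|j]]]] // _ _;
  by rewrite /t' /=; case: (t 4).
Qed.

Lemma two_path_trichotomy (G : sgraph) :
  two_path G -> [\/ star_colorable 4 G, embeds H1 G | embeds H2 G].
Proof.
case/two_pathE=> t [n [n2 isoG]].
have Gs := isomorphic_embeds isoG; have sG := isomorphic_embeds (isomorphic_sym isoG).
case: (strip_trichotomy t n2) => [cols|H1s|H2s].
- by apply: Or31; apply: embeds_star_colorable cols.
- by apply: Or32; apply: embeds_trans H1s sG.
by apply: Or33; apply: embeds_trans H2s sG.
Qed.

(** An induced copy of H on a proper vertex set would inherit a colouring. *)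
Lemma minimal_obstruction_iso k (G H : sgraph) :
  minimal_obstruction k G -> ~ star_colorable k H -> embeds H G -> isomorphic G H.
Proof.
case=> _ minG ncolH HG; apply: isomorphic_sym; apply: embeds_isomorphic => //.
rewrite leqNgt; apply/negP=> ltHG; have [S cardS isoS] := embeds_induced HG.
apply: ncolH; apply: embeds_star_colorable (minG S _).
  exact/isomorphic_embeds/isomorphic_sym.
by rewrite properEcard subsetT cardS cardsT.
Qed.

Theorem theorem4p6 :
  (forall G : sgraph, two_path G ->
     (star_colorable 4 G <-> induced_free H1 G /\ induced_free H2 G)) /\
  (forall G : sgraph,
     two_path G /\ minimal_obstruction 4 G <->
     isomorphic G H1 \/ isomorphic G H2).
Proof.
split=> [G pathG|G].
  split=> [colG|[/induced_freeE noH1 /induced_freeE noH2]].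
    split; apply/induced_freeE=> /embeds_star_colorable/(_ colG).
      exact: H1_not_colorable.
    exact: H2_not_colorable.
  by case: (two_path_trichotomy pathG).
split=> [[pathG minG]|].
  case: (two_path_trichotomy pathG) => [/minG.1 //|H1G|H2G].
    by left; apply: minimal_obstruction_iso minG H1_not_colorable H1G.
  by right; apply: minimal_obstruction_iso minG H2_not_colorable H2G.
have trans (F K : sgraph) : isomorphic F K -> isomorphic G F -> isomorphic G K.
  move=> FK GF; apply: embeds_isomorphic.
    exact: embeds_trans (isomorphic_embeds GF) (isomorphic_embeds FK).
  by case: FK GF => f bijf _ [g bijg _]; rewrite -(bij_eq_card bijf) (bij_eq_card bijg).
case=> isoG; split.
- by apply/two_pathE; exists xpredT, 7; split=> //; apply: trans H1_strip isoG.
- split; last exact: isomorphic_proper_colorable isoG H1_proper_colorable.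
  have H1G := isomorphic_embeds (isomorphic_sym isoG).
  by move/(embeds_star_colorable H1G); apply: H1_not_colorable.
- by apply/two_pathE; exists (pred1 6), 10; split=> //; apply: trans H2_strip isoG.
split; last exact: isomorphic_proper_colorable isoG H2_proper_colorable.
have H2G := isomorphic_embeds (isomorphic_sym isoG).
by move/(embeds_star_colorable H2G); apply: H2_not_colorable.
Qed.
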